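(* Let $\{(X_i,\mathcal U_i):i\in I\}$ be a family of $g$-quasi uniform spaces with $I\neq\emptyset$, and let $(X,\mathcal U)$ be its product $g$-quasi uniform space. Then $(X,\mathcal U)$ is $G$-complete if and only if $(X_i,\mathcal U_i)$ is $G$-complete for each $i\in I$.
   Context: A $g$-quasi uniformity (generalized quasi-uniformity) on a nonempty set $Z$ is a nonempty collection $\mathcal V\subset\mathcal P(Z\times Z)$ such that (i) $\Delta(Z)=\{(z,z):z\in Z\}\subset U$ for all $U\in\mathcal V$; (ii) $U\in\mathcal V$ and $U\subset V\subset Z\times Z$ imply $V\in\mathcal V$; (iii) for each $U\in\mathcal V$ there is $V\in\mathcal V$ with $V\circ V\subset U$, where $V\circ V=\{(x,z):\exists y,\ (x,y)\in V,(y,z)\in V\}$. (Closure under intersection is not required.) The pair $(Z,\mathcal V)$ is called a $g$-quasi uniform space. Product: for a family $\{(X_i,\mathcal U_i):i\in I\}$ of $g$-quasi uniform spaces, let $X=\prod_{i\in I}X_i$ with projections $\pi_i:X\to X_i$. The product $g$-quasi uniformity $\mathcal U$ on $X$ is the one with base $\{(\pi_i\times\pi_i)^{-1}(U_i):U_i\in\mathcal U_i,\ i\in I\}$, i.e. $\mathcal U=\{V\subset X\times X: (\pi_i\times\pi_i)^{-1}(U_i)\subset V\text{ for some }i\in I,\ U_i\in\mathcal U_i\}$ (no finite intersections are taken). $(X,\mathcal U)$ is the product $g$-quasi uniform space. For $U\in\mathcal V$ and $x\in Z$ put $U(x)=\{y\in Z:(x,y)\in U\}$. The collection $\mu(\mathcal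 V)=\{G\subset Z: \text{for every }x\in G\text{ there is }U\in\mathcal V\text{ with }U(x)\subset G\}$ is the induced supratopology. A generalized neighborhood of $a\in Z$ is a set $A\subset Z$ with $a\in G\subset A$ for some $G\in\mu(\mathcal V)$. A sequence $(x_n)_{n\in\mathbb N}$ in $Z$ converges to $c\in Z$ if for every generalized neighborhood $A$ of $c$ there is $m\in\mathbb N$ with $x_n\in A$ for all $n\ge m$. It is $G$-Cauchy if for every $U\in\mathcal V$ there is $k\in\mathbb N$ such that $(x_n,x_{n+1})\in U$ for all $n\ge k$. $(Z,\mathcal V)$ is $G$-complete if every $G$-Cauchy sequence in $Z$ converges to some point of $Z$. *)

(* Defs.v *)
From mathcomp Require Import all_boot.
From mathcomp Require Import boolp classical_sets filter mathcomp_extra.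

Set Implicit Arguments.
Unset Strict Implicit.
Unset Printing Implicit Defensive.

Local Open Scope classical_set_scope.

Record is_gqunif (Z : Type) (V : set (set (Z * Z))) : Prop := IsGQUnif {
  gqunif_nonempty : V !=set0 ;
  gqunif_diag : forall U, V U -> diagonal `<=` U ;
  gqunif_sup : forall U W, V U -> U `<=` W -> V W ;
  gqunif_split : forall U, V U -> exists2 W, V W & (W \; W)%relation `<=` U }.

Record gqunifSpace := GQUnifSpace {
  gqu_point :> Type ;
  gqu_point_nonempty : [set: gqu_point] !=set0 ;
  gqu_ent : set (set (gqu_point * gqu_point)) ;
  gqu_entP : is_gqunif gqu_ent }.

Section Product.
Variables (I : Type) (X : I -> gqunifSpace).

Definition prod_proj2 (i : I) (p : (forall i, X i) * (forall i, X i)) :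
  X i * X i := (proj i p.1, proj i p.2).

Definition prod_ent : set (set ((forall i, X i) * (forall i, X i))) :=
  [set V | exists i, exists2 U, gqu_ent U & prod_proj2 i @^-1` U `<=` V].

Lemma prod_point_nonempty : [set: forall i, X i] !=set0.
Proof.
by exists (fun i => projT1 ( cid (gqu_point_nonempty (X i)))).
Qed.

(* A nonempty index set is needed: over an empty one, prod_ent is empty. *)
Lemma prod_entP : [set: I] !=set0 -> is_gqunif prod_ent.
Proof.
case=> i0 _; split.
- have [U XU] := gqunif_nonempty (gqu_entP (X i0)).
  by exists (prod_proj2 i0 @^-1` U), i0, U.
- move=> V [i [U XU UV]] [x y] /diagonalP ->; apply: UV.
  exact: (gqunif_diag (gqu_entP (X i)) XU).
- move=> V W [i [U XU UV]] VW; exists i, U => //.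
  exact: subset_trans UV VW.
- move=> V [i [U XU UV]].
  have [W XW WU] := gqunif_split (gqu_entP (X i)) XU.
  exists (prod_proj2 i @^-1` W); first by exists i, W.
  move=> [x z] [y /= xy yz]; apply: UV; apply: WU.
  by exists (proj i y).
Qed.

Definition prod_gqunif (I0 : [set: I] !=set0) : gqunifSpace :=
  GQUnifSpace prod_point_nonempty (prod_entP I0).

End Product.

Section Completeness.
Variable Z : gqunifSpace.

Definition supratopology : set (set Z) :=
  [set G | forall x, G x -> exists2 U, gqu_ent U & xsection U x `<=` G].

Definition gnbhs (a : Z) : set (set Z) :=
  [set A | exists G, [/\ supratopology G, G a & G `<=` A]].

Definition gconverges (x : nat -> Z) (c : Z) : Prop :=
  forall A, gnbhs c A -> \forall n \near \oo, A (x n).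

Definition G_Cauchy (x : nat -> Z) : Prop :=
  forall U, gqu_ent U -> \forall n \near \oo, U (x n, x n.+1).

Definition G_complete : Prop :=
  forall x : nat -> Z, G_Cauchy x -> exists c, gconverges x c.

End Completeness.

(* Main.v *)
Require Import Defs.
From mathcomp Require Import all_boot.
From mathcomp Require Import boolp classical_sets filter mathcomp_extra.

(** Both convergence and the G-Cauchy property in a product are coordinatewise,
    so completeness passes between the product and its factors.  For Cauchy
    sequences ([G_Cauchy_prod]) this is immediate, because each basic entourage
    of the product constrains a single coordinate.  For convergence
    ([gconverges_prod]) the one point with content is that [U(a)] is a
    generalized neighborhood of [a] for every entourage [U]
    ([gnbhs_xsection]).  Convergence can then be tested on entourages
    ([gconvergesP]), and hence on the basic ones.

    If all factors are complete, a limit of a Cauchy sequence of the product is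
    assembled from limits of its coordinates.  Conversely, a Cauchy sequence of
    a factor is turned into a Cauchy sequence of the product by keeping all
    other coordinates at a fixed base point; constant sequences are Cauchy
    because entourages contain the diagonal, and the relevant coordinate of a
    limit in the product is a limit in the factor. *)

Set Implicit Arguments.
Unset Strict Implicit.
Unset Printing Implicit Defensive.

Local Open Scope classical_set_scope.

(** The generalized interior [{y | V(y) `<=` U(a) for some entourage V}] is
    open: if [W \; W `<=` V], then every point [z] of [W(y)] satisfies
    [W(z) `<=` V(y) `<=` U(a)]. *)
Lemma gnbhs_xsection (Z : gqunifSpace) (U : set (Z * Z)) (a : Z) :
  gqu_ent U -> gnbhs a (xsection U a).
Proof.
move=> ZU; have ZP := gqu_entP Z.
exists [set y | exists2 V, gqu_ent V & xsection V y `<=` xsection U a]; split.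
- move=> y [V ZV VU]; have [W ZW WV] := gqunif_split ZP ZV.
  exists W => // z /xsectionP yz; exists W => // t /xsectionP zt.
  by apply/VU/xsectionP/WV; exists z.
- by exists U.
- move=> y [V ZV]; apply; apply/xsectionP.
  by apply: (gqunif_diag ZP ZV); apply/diagonalP.
Qed.

Lemma gconvergesP (Z : gqunifSpace) (x : nat -> Z) (c : Z) :
  gconverges x c <->
  forall U, gqu_ent U -> \forall n \near \oo, U (c, x n).
Proof.
split=> [xc U ZU|xc A [G [oG Gc GA]]].
- have := xc _ (gnbhs_xsection c ZU).
  by apply: filterS => n /xsectionP.
- have [U ZU UG] := oG c Gc.
  by apply: filterS (xc U ZU) => n cx; apply/GA/UG/xsectionP.
Qed.

Lemma G_Cauchy_cst (Z : gqunifSpace) (a : Z) : G_Cauchy (fun=> a).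
Proof.
move=> U ZU; apply: nearW => _.
by apply: (gqunif_diag (gqu_entP Z) ZU); apply/diagonalP.
Qed.

Section Product.
Variables (I : Type) (I0 : [set: I] !=set0) (X : I -> gqunifSpace).

Lemma G_Cauchy_prod (x : nat -> prod_gqunif X I0) :
  G_Cauchy x <-> forall i, G_Cauchy (fun n => x n i).
Proof.
split=> [xC i U XU|xC V [i [U XU UV]]].
- by apply: (xC (prod_proj2 i @^-1` U)); exists i, U.
- by apply: filterS (xC i U XU) => n xU; apply: UV.
Qed.

Lemma gconverges_prod (x : nat -> prod_gqunif X I0) (c : prod_gqunif X I0) :
  gconverges x c <-> forall i, gconverges (fun n => x n i) (c i).
Proof.
split=> [/gconvergesP xc i|xc]; apply/gconvergesP.
- move=> U XU.
  by apply: (xc (prod_proj2 i @^-1` U)); exists i, U.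
- move=> V [i [U XU UV]].
  have /gconvergesP/(_ U XU) := xc i.
  by apply: filterS => n xU; apply: UV.
Qed.

End Product.

Theorem theorem4p9 (I : Type) (I0 : [set: I] !=set0) (X : I -> gqunifSpace) :
  G_complete (prod_gqunif X I0) <-> (forall i : I, G_complete (X i)).
Proof.
split=> [cX i x xC|cX x /G_Cauchy_prod xC]; last first.
  have xc i := cid (cX i _ (xC i)).
  by exists (fun i => sval (xc i)); apply/gconverges_prod => i; case: (xc i).
have [p _] := prod_point_nonempty X.
(* [dfwith] tests indices for equality, hence the classical [eqType] on [I]. *)
pose y n : prod_gqunif X I0 := @dfwith {classic I} X p i (x n).
have yi n : y n i = x n by exact: dfwithin.
have yC : G_Cauchy y.
  apply/G_Cauchy_prod => j; have [ij|ij] := pselect (i = j).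
    by case: _ / ij; rewrite (funext yi).
  have -> : (fun n => y n j) = fun=> p j.
    by apply/funext => n; apply: (@dfwithout {classic I}); apply/eqP.
  exact: G_Cauchy_cst.
have [c /gconverges_prod/(_ i)] := cX y yC.
by rewrite (funext yi); exists (c i).
Qed.
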